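(* Let $n\ge 0$. If $n$ is even and $w\in F_{\mathrm{odd}}(n)$, then $w^+\cap F_{\mathrm{odd}}(n+1)=\{1w\}$. If $n$ is odd and $w\in F_{\mathrm{odd}}(n)$, then $w=1v$ for a unique $v\in F_{\mathrm{odd}}(n-1)$, and $w^+\cap F_{\mathrm{odd}}(n+1)=\{11v,\,2v\}$. Consequently, the subgraph $F_{\mathrm{odd}}$ of the Young–Fibonacci graph induced by the odd words is a binary tree (rooted at $\emptyset$) in which every node of even rank has exactly one child and every node of odd rank has exactly two children.
   Context: For $n\ge 0$, let $F(n)$ be the set of all words $w=x_1\dotsb x_l$ with each $x_i\in\{1,2\}$ and $\sum_i x_i=n$; the rank of such $w$ is $n$, and $F=\coprod_{n\ge0}F(n)$ ($F(0)$ contains only the empty word $\emptyset$). The Young–Fibonacci graph has vertex set $F$, with an edge between $v\in F(n)$ and $w\in F(n+1)$ (written $v\in w^-$, $w\in v^+$) iff either (1) $v$ is obtained from $w$ by changing into a $1$ some $2$ of $w$ that has no $1$ to its left, or (2) $v$ is obtained from $w$ by removing its leftmost $1$. The $f$-statistic is defined by $f_\emptyset=1$ and $f_w=\sum_{v\in w^-}f_v$. A word $w$ is odd if $f_w$ is odd; $F_{\mathrm{odd}}(n)$ denotes the set of odd words in $F(n)$, and $F_{\mathrm{odd}}$ the subgraph of the Young–Fibonacci graph induced by all odd words. Children of a node of rank $n$ are its neighbours of rank $n+1$. *)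

(* Defs.v *)
From HB Require Import structures.
From mathcomp Require Import all_boot.

Set Implicit Arguments.
Unset Strict Implicit.
Unset Printing Implicit Defensive.

Section Graphs.
Variables (V : eqType) (e : rel V).

Definition graph_connected : Prop :=
  forall x y : V, exists2 p : seq V, path e x p & last x p = y.

Definition graph_acyclic : Prop :=
  forall c : seq V, 2 < size c -> ~ ucycle e c.

Definition is_tree : Prop :=
  [/\ irreflexive e, symmetric e, graph_connected & graph_acyclic].

(* [y] is a child of [x] when [x] is the last vertex before [y] on a simple
   path from the root [r] to [y]. *)
Definition tree_child (r x y : V) : Prop :=
  exists q : seq V,
    [/\ path e r (rcons q y), uniq (r :: rcons q y) & last r q = x].

Definition is_binary_tree (r : V) : Prop :=
  is_tree /\
  forall x : V, exists2 s : seq V,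
    size s <= 2 & forall y : V, tree_child r x y -> y \in s.

End Graphs.

Definition has_exactly (T : eqType) (k : nat) (P : T -> Prop) : Prop :=
  exists s : seq T, [/\ uniq s, size s = k & forall x : T, x \in s <-> P x].

Definition induced (T : eqType) (P : pred T) (e : rel T) : rel {x : T | P x} :=
  [rel x y | e (val x) (val y)].
Arguments induced {T} P e.

Inductive letter := One | Two.

Definition letter_val (x : letter) : nat := if x is One then 1 else 2.

Definition letter_of_nat (n : nat) : letter := if n is 1 then One else Two.

Lemma letter_valK : cancel letter_val letter_of_nat.
Proof. by case. Qed.

HB.instance Definition _ := Equality.copy letter (can_type letter_valK).

Definition word := seq letter.

Definition rank (w : word) : nat := \sum_(x <- w) letter_val x.

Definition F (n : nat) : pred word := [pred w | rank w == n].

Definition change_two (w : word) : seq word :=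
  [seq set_nth One w i One | i <- iota 0 (size w)
                           & (nth One w i == Two) && (One \notin take i w)].

(* [rem One w] deletes only the first, i.e. leftmost, [One] of [w]. *)
Definition remove_one (w : word) : seq word :=
  if One \in w then [:: rem One w] else [::].

(* w^-, as a duplicate-free list *)
Definition down (w : word) : seq word := undup (change_two w ++ remove_one w).

(* v^+ *)
Definition up (v : word) : pred word := [pred w | v \in down w].

Definition YF_adj : rel word := [rel v w | (v \in down w) || (w \in down v)].

Fixpoint fstat_rec (k : nat) (w : word) : nat :=
  if k is k'.+1 then \sum_(v <- down w) fstat_rec k' v else 1.

(* The recursion runs on the rank, which drops by exactly one along each edge;
   [fstat0] and [fstatE] are the defining equations. *)
Definition fstat (w : word) : nat := fstat_rec (rank w) w.

Lemma rank_nil : rank [::] = 0.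
Proof. by rewrite /rank big_nil. Qed.

Lemma rank_cons x w : rank (x :: w) = letter_val x + rank w.
Proof. by rewrite /rank big_cons. Qed.

Lemma rank_down (v w : word) : v \in down w -> rank w = (rank v).+1.
Proof.
rewrite mem_undup mem_cat => /orP[|].
  case/mapP=> i; rewrite mem_filter mem_iota add0n => /andP[/andP[/eqP wi _]].
  rewrite /= => lt_iw ->.
  elim: w i wi lt_iw => [|x w IHw] [|i] //=.
    by move=> -> _; rewrite !rank_cons.
  by move=> wi lt_iw; rewrite !rank_cons (IHw i wi lt_iw) addnS.
rewrite /remove_one; case: ifP => // w1; rewrite inE => /eqP->.
elim: w w1 => //= x w IHw; rewrite inE; case: (eqVneq x One) => [-> _|].
  by rewrite rank_cons.
move=> _ /= w1.
by rewrite !rank_cons (IHw w1) addnS.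
Qed.

Lemma fstat0 : fstat [::] = 1.
Proof. by rewrite /fstat rank_nil. Qed.

Lemma fstatE (w : word) : w != [::] -> fstat w = \sum_(v <- down w) fstat v.
Proof.
case: w => // x w _; rewrite /fstat.
have [k rk] : exists k, rank (x :: w) = k.+1.
  by rewrite rank_cons; case: x => /=; eexists; rewrite ?add1n ?add2n.
rewrite rk /=; apply: eq_big_seq => v /rank_down.
by rewrite rk => -[->].
Qed.

Definition odd_word : pred word := [pred w | odd (fstat w)].

Definition Fodd (n : nat) : pred word := [predI F n & odd_word].

Definition odd_node := {w : word | odd_word w}.

Definition Fodd_graph : rel odd_node := induced odd_word YF_adj.

Lemma odd_word_nil : odd_word [::].
Proof. exact: (congr1 odd fstat0). Qed.

Definition empty_node : odd_node := exist _ [::] odd_word_nil.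

Definition child (w u : odd_node) : Prop :=
  Fodd_graph w u /\ rank (val u) = (rank (val w)).+1.

(* Main.v *)
Require Import Defs.
From HB Require Import structures.
From mathcomp Require Import all_boot.

Set Implicit Arguments.
Unset Strict Implicit.
Unset Printing Implicit Defensive.

(** The recursions [f(1w) = f(w)] and [f(2w) = (rank w + 1) f(w)] show that [1w]
    is odd iff [w] is, and that [2w] is odd iff [w] is odd of even rank. Hence
    odd words of odd rank start with [1], which determines the odd neighbours
    of an odd word. In particular a nonempty odd word has exactly one odd
    neighbour of smaller rank, and a graded graph in which every vertex but the
    root has exactly one lower neighbour is a tree: a vertex of maximal rank on
    a cycle would have two of them. *)

(** * Trees from graded graphs *)

Section GradedTree.
Variables (V : eqType) (e : rel V) (rk : V -> nat) (r : V).
Hypothesis e_sym : symmetric e.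
Hypothesis e_rank :
  forall x y, e x y -> rk y = (rk x).+1 \/ rk x = (rk y).+1.
Hypothesis lower_uniq : forall x y z, e x z -> e y z ->
  rk z = (rk x).+1 -> rk z = (rk y).+1 -> x = y.
Hypothesis lower_ex :
  forall x, x != r -> exists2 y, e x y & rk x = (rk y).+1.
Hypothesis rk_root : rk r = 0.

Lemma graded_irreflexive : irreflexive e.
Proof.
by move=> x; apply/negP => /e_rank[] /eqP; rewrite (ltn_eqF, gtn_eqF).
Qed.

Lemma path_to_root x : exists2 p, path e x p & last x p = r.
Proof.
have [n] := ubnP (rk x); elim: n x => // n IHn x lt_xn.
have [->|/lower_ex[y exy rk_x]] := eqVneq x r; first by exists [::].
have [|p e_p last_p] := IHn y; first by rewrite rk_x in lt_xn.
by exists (y :: p) => //=; rewrite exy.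
Qed.

Lemma graded_connected : graph_connected e.
Proof.
move=> x y; have [p e_p last_p] := path_to_root x.
have [q e_q last_q] := path_to_root y.
(* The descent [q] from [y] is walked backwards; [belast] drops its endpoint [r], which [p] has
   already reached, and keeps [y] as the final vertex. *)
exists (p ++ rev (belast y q)).
  rewrite cat_path e_p last_p -last_q rev_path.
  by rewrite (eq_path (e' := e)) // => u v; rewrite /= e_sym.
rewrite last_cat last_p.
case: q e_q last_q => [|z q] _ /=; first by [].
by rewrite rev_cons last_rcons.
Qed.

Lemma graded_acyclic : graph_acyclic e.
Proof.
move=> c size_c /andP[cyc_c uniq_c].
have [x xc max_x] : exists2 x, x \in c & forall y, y \in c -> rk y <= rk x.
  case: c size_c {cyc_c uniq_c} => // a c _.
  elim: c a => [|b c IHc] a.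
    by exists a => [|y]; rewrite ?mem_head // inE => /eqP->.
  have [x xc max_x] := IHc b; have [le_ax|/ltnW le_xa] := leqP (rk a) (rk x).
    exists x => [|y]; first by rewrite inE xc orbT.
    by rewrite inE => /predU1P[->|/max_x].
  exists a => [|y]; first exact: mem_head.
  by rewrite inE => /predU1P[->|/max_x/leq_trans->].
(* Rotating the cycle puts [x] first, so that its two neighbours on the cycle are the second and the
   last entries. *)
have [i p def_c] := rot_to xc.
have lowx y : e y x -> y \in c -> rk x = (rk y).+1.
  by move=> /e_rank[] // rk_y /max_x; rewrite rk_y ltnn.
move: size_c cyc_c uniq_c.
rewrite -(size_rot i) -(rot_cycle i) -(rot_uniq i) def_c => size_p cyc_p uniq_p.
have {}lowx y : e y x -> y \in x :: p -> rk x = (rk y).+1.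
  by move=> eyx; rewrite -def_c mem_rot; apply: lowx.
case: p {def_c} size_p cyc_p uniq_p lowx => // y p.
(* Length greater than 2 provides a last vertex [z] at a position after that of [y]. *)
case/lastP: p => // p z _.
rewrite /= rcons_path last_rcons => /and3P[exy _ ezx] /and3P[_ y_notin _] lowx.
have zp : z \in rcons p z by rewrite mem_rcons mem_head.
have eyx : e y x by rewrite e_sym.
have /eqP : y = z.
  by apply: lower_uniq (lowx _ eyx _) (lowx _ ezx _); rewrite // !inE ?eqxx ?zp ?orbT.
by apply/negP; apply: contraNneq y_notin => ->.
Qed.

(** A simple path from the root only climbs. Its first step leaves rank 0; a later step down from
    [z] would reach the unique lower neighbour of [z], which by induction is the vertex visited just
    before [z]. *)
Lemma graded_tree_child x y :
  tree_child e r x y -> e x y /\ rk y = (rk x).+1.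
Proof.
case=> q [e_q uniq_q <-] {x}.
elim/last_ind: q y e_q uniq_q => [|q z IHq] y.
  rewrite /= andbT => ery _; split=> //.
  by case: (e_rank ery) => // /eqP; rewrite rk_root.
rewrite rcons_path last_rcons -rcons_cons rcons_uniq => /andP[e_q ezy].
case/andP=> y_notin uniq_q; split=> //.
have [e_z rk_z] := IHq z e_q uniq_q.
case: (e_rank ezy) => // rk_z'.
have eyz : e y z by rewrite e_sym.
case/negP: y_notin; rewrite (lower_uniq eyz e_z rk_z' rk_z).
by rewrite -rcons_cons mem_rcons inE mem_last orbT.
Qed.

Lemma graded_is_tree : is_tree e.
Proof.
split; [exact: graded_irreflexive | exact: e_sym | exact: graded_connected|].
exact: graded_acyclic.
Qed.

End GradedTree.

(** * Lower neighbours of words and the parity of [fstat] *)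

Lemma down_nil : down [::] = [::].
Proof. by []. Qed.

Lemma down_One w : down (One :: w) = [:: w].
Proof.
rewrite /down /change_two /remove_one mem_head.
rewrite (@eq_in_filter _ _ pred0) ?filter_pred0 //.
by case=> // i _; rewrite /= andbF.
Qed.

(** Either the leading 2 becomes a 1, or the operation takes place inside [w], where a 2 in front
    obstructs nothing. *)
Lemma down_Two w : down (Two :: w) = (One :: w) :: map (cons Two) (down w).
Proof.
have inj2 : injective (cons Two) by move=> u v [].
have ct2 : change_two (Two :: w) = (One :: w) :: map (cons Two) (change_two w).
  rewrite /change_two /= (iotaDl 1 0) filter_map -!map_comp.
  by congr (_ :: _); congr map; apply: eq_filter => i /=; rewrite inE.
rewrite /down ct2 -(undup_map_inj inj2) map_cat.
have -> : remove_one (Two :: w) = map (cons Two) (remove_one w).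
  by rewrite /remove_one inE /=; case: ifP.
(* [undup] keeps the head: it starts with 1, all other entries with 2. *)
rewrite /= ifN // -map_cat; apply/mapP=> -[]//.
Qed.

Lemma fstat_One w : fstat (One :: w) = fstat w.
Proof. by rewrite fstatE // down_One big_seq1. Qed.

(** Below [2w], the word [1w] contributes [f(w)], and by induction each [2v] with [v] below [w]
    contributes [rank w * f(v)], since [rank v + 1 = rank w]. *)
Lemma fstat_Two w : fstat (Two :: w) = (rank w).+1 * fstat w.
Proof.
have [n] := ubnP (rank w); elim: n w => // n IHn w lt_wn.
rewrite fstatE // down_Two big_cons big_map fstat_One mulSn; congr (_ + _).
(* The empty word is apart because [fstat [::]] is 1 rather than an empty sum; here the factor
   [rank w] is 0. *)
have [->|w_neq0] := eqVneq w [::]; first by rewrite down_nil big_nil rank_nil.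
rewrite [in RHS]fstatE // big_distrr; apply: eq_big_seq => v /rank_down rk_w.
by rewrite IHn -?rk_w // -ltnS -rk_w.
Qed.

Lemma odd_word_One w : odd_word (One :: w) = odd_word w.
Proof. exact: (congr1 odd (fstat_One w)). Qed.

Lemma odd_word_Two w : odd_word (Two :: w) = ~~ odd (rank w) && odd_word w.
Proof. by apply: etrans (congr1 odd (fstat_Two w)) _; rewrite oddM. Qed.

(** If [2w] has odd rank then so has [w], and the factor [rank w + 1] of [f(2w)] is even. *)
Lemma odd_word_odd_rank w :
  odd_word w -> odd (rank w) -> exists2 v, w = One :: v & odd_word v.
Proof.
case: w => [|[] w]; first by rewrite rank_nil.
  by rewrite odd_word_One; exists w.
by rewrite odd_word_Two rank_cons /= negbK => /andP[/negbTE->].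
Qed.

(** When [2w] is odd, [w] has even rank, so any [v] below [w] has odd rank and [2v] is not odd; only
    [1w] remains. *)
Lemma odd_down_uniq u v w : odd_word u -> odd_word v -> odd_word w ->
  u \in down w -> v \in down w -> u = v.
Proof.
move=> odd_u odd_v; case: w => [|[] w]; first by rewrite down_nil.
  by rewrite down_One !inE => _ /eqP-> /eqP->.
rewrite odd_word_Two => /andP[even_w _].
have lower x : odd_word x -> x \in down (Two :: w) -> x = One :: w.
  rewrite down_Two inE => odd_x /predU1P[//|/mapP[y /rank_down rk_w def_x]].
  by move: odd_x even_w; rewrite def_x odd_word_Two rk_w /= => /andP[/negbTE->].
by move=> /(lower _ odd_u)-> /(lower _ odd_v)->.
Qed.

Lemma odd_down_ex w : odd_word w -> w != [::] ->
  exists2 v, odd_word v & v \in down w.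
Proof.
case: w => [|[] w] //; rewrite ?odd_word_One ?odd_word_Two.
  by exists w => //; rewrite down_One mem_head.
by case/andP=> _ odd_w _; exists (One :: w); rewrite ?odd_word_One // down_Two mem_head.
Qed.

(** An odd [u] above [w] has odd rank, hence starts with 1, and removing that 1 gives its only lower
    neighbour. *)
Lemma odd_up_even_rank w u : odd_word w -> ~~ odd (rank w) ->
  (w \in down u) && odd_word u = (u == One :: w).
Proof.
move=> odd_w even_w; apply/andP/eqP => [[wu odd_u]|->]; last first.
  by rewrite down_One mem_head odd_word_One.
have odd_rk : odd (rank u) by rewrite (rank_down wu).
have [v def_u _] := odd_word_odd_rank odd_u odd_rk.
by move: wu; rewrite def_u down_One inE => /eqP->.
Qed.

(** The words above [1v] are always [11v] and [2v], because the only word below [2u] that starts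
    with 1 is [1u]; the parity assumptions make both of them odd. *)
Lemma odd_up_odd_rank v u : odd_word v -> ~~ odd (rank v) ->
  (One :: v \in down u) && odd_word u = (u \in [:: One :: One :: v; Two :: v]).
Proof.
move=> odd_v even_v; rewrite !inE; apply/andP/orP => [[vu _]|].
  case: u vu => [|[] u]; rewrite ?down_One ?down_Two ?inE //.
    by move/eqP->; left.
  by case/predU1P=> [[->]|/mapP[]//]; right.
case=> /eqP->; first by rewrite down_One mem_head !odd_word_One.
by rewrite down_Two mem_head odd_word_Two even_v.
Qed.

Lemma mem_Fodd n w : (w \in Fodd n) = (rank w == n) && odd_word w.
Proof. by []. Qed.

Lemma mem_up_Fodd n w u : w \in Fodd n ->
  (u \in [predI up w & Fodd n.+1]) = (w \in down u) && odd_word u.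
Proof.
rewrite mem_Fodd => /andP[/eqP <- _]; rewrite inE mem_Fodd.
have -> : (u \in up w) = (w \in down u) by [].
by case wu: (w \in down u) => //=; rewrite (rank_down wu) eqxx.
Qed.

Lemma Fodd_up_even n w : ~~ odd n -> w \in Fodd n ->
  [predI up w & Fodd n.+1] =i [:: One :: w].
Proof.
move=> even_n w_n u; rewrite (mem_up_Fodd _ w_n) mem_seq1.
move: w_n; rewrite mem_Fodd => /andP[/eqP rk_w odd_w].
by rewrite odd_up_even_rank // rk_w.
Qed.

Lemma Fodd_up_odd n w : odd n -> w \in Fodd n ->
  exists v : word,
    [/\ v \in Fodd n.-1,
        w = One :: v,
        forall v' : word, v' \in Fodd n.-1 -> w = One :: v' -> v' = v
      & [predI up w & Fodd n.+1] =i [:: One :: One :: v; Two :: v]].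
Proof.
move=> odd_n w_n; have := w_n; rewrite mem_Fodd => /andP[/eqP rk_w odd_w].
have odd_rk : odd (rank w) by rewrite rk_w.
have [v def_w odd_v] := odd_word_odd_rank odd_w odd_rk.
have def_n : n = (rank v).+1 by rewrite -rk_w def_w rank_cons.
exists v; split=> //; first by rewrite mem_Fodd def_n eqxx.
  by rewrite def_w => v' _ [].
move=> u; rewrite (mem_up_Fodd _ w_n) def_w odd_up_odd_rank //.
by rewrite def_n in odd_n.
Qed.

(** * Children in the induced graph *)

Lemma childE (w u : odd_node) : child w u <-> val w \in down (val u).
Proof.
split=> [[/orP[//|uw] rk_u]|wu].
  by have /eqP := rank_down uw; rewrite rk_u ltn_eqF.
by split; [apply/orP; left | exact: rank_down].
Qed.

(** Carries a count of words over to the subtype of odd words: all entries of [s] are odd, so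
    [insub] discards none. *)
Lemma has_exactly_child (w : odd_node) (s : seq word) : uniq s ->
  (forall u, (val w \in down u) && odd_word u = (u \in s)) ->
  has_exactly (size s) (child w).
Proof.
move=> uniq_s mem_s.
have odd_s : all odd_word s by apply/allP=> u; rewrite -mem_s => /andP[].
exists (pmap (insub : word -> option odd_node) s); split.
- exact: pmap_sub_uniq.
- by rewrite size_pmap_sub; apply/eqP; rewrite -all_count.
- move=> u; rewrite mem_pmap_sub -mem_s (valP u) andbT.
  by split=> /childE.
Qed.

Lemma child_even (w : odd_node) :
  ~~ odd (rank (val w)) -> has_exactly 1 (child w).
Proof.
move=> even_w; apply: (@has_exactly_child w [:: One :: val w]) => // u.
by rewrite odd_up_even_rank ?mem_seq1 // (valP w).
Qed.

Lemma child_odd (w : odd_node) :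
  odd (rank (val w)) -> has_exactly 2 (child w).
Proof.
move=> odd_rk; have [v def_w odd_v] := odd_word_odd_rank (valP w) odd_rk.
apply: (@has_exactly_child w [:: One :: One :: v; Two :: v]) => // u.
rewrite def_w odd_up_odd_rank //.
by move: odd_rk; rewrite def_w rank_cons.
Qed.

Lemma Fodd_binary_tree : is_binary_tree Fodd_graph empty_node.
Proof.
pose rk (w : odd_node) := rank (val w).
have e_sym : symmetric Fodd_graph by move=> u v; apply: orbC.
have e_rank u v : Fodd_graph u v -> rk v = (rk u).+1 \/ rk u = (rk v).+1.
  by case/orP=> /rank_down; [left | right].
have lower_uniq x y z : Fodd_graph x z -> Fodd_graph y z ->
    rk z = (rk x).+1 -> rk z = (rk y).+1 -> x = y.
  move=> exz eyz rk_x rk_y; have /childE xz : child x z by [].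
  have /childE yz : child y z by [].
  exact/val_inj/(odd_down_uniq (valP x) (valP y) (valP z)).
have lower_ex x : x != empty_node ->
    exists2 y, Fodd_graph x y & rk x = (rk y).+1.
  move=> x_neq0; have [v odd_v vx] := odd_down_ex (valP x) x_neq0.
  by exists (exist _ v odd_v); [apply/orP; right | exact: rank_down].
have rk_root : rk empty_node = 0 by exact: rank_nil.
split; first exact: (graded_is_tree e_sym e_rank lower_uniq lower_ex).
(* Tree children, defined by simple paths from the root, are children in the sense of rank, so a
   list of the latter bounds them. *)
have few_children x k : k <= 2 -> has_exactly k (child x) ->
    exists2 s : seq odd_node, size s <= 2 &
      forall y, tree_child Fodd_graph empty_node x y -> y \in s.
  move=> le_k2 [s [_ size_s mem_s]]; exists s; first by rewrite size_s.
  move=> y /(graded_tree_child e_sym e_rank lower_uniq rk_root) xy.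
  exact/mem_s.
move=> x; case odd_x: (odd (rank (val x))).
  by apply: (few_children x 2) => //; apply: child_odd.
by apply: (few_children x 1) => //; apply: child_even; rewrite odd_x.
Qed.

Theorem mainTheorem4 :
  (forall (n : nat) (w : word), ~~ odd n -> w \in Fodd n ->
     [predI up w & Fodd n.+1] =i [:: One :: w])
  /\
  (forall (n : nat) (w : word), odd n -> w \in Fodd n ->
     exists v : word,
       [/\ v \in Fodd n.-1,
           w = One :: v,
           forall v' : word, v' \in Fodd n.-1 -> w = One :: v' -> v' = v
         & [predI up w & Fodd n.+1] =i [:: One :: One :: v; Two :: v]])
  /\
  (is_binary_tree Fodd_graph empty_node
   /\ (forall w : odd_node, ~~ odd (rank (val w)) -> has_exactly 1 (child w))
   /\ (forall w : odd_node, odd (rank (val w)) -> has_exactly 2 (child w))).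
Proof.
split; first exact: Fodd_up_even.
split; first exact: Fodd_up_odd.
by split; [exact: Fodd_binary_tree | split; [exact: child_even | exact: child_odd]].
Qed.
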